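(* Let $K$ be a field, let $n\ge 3$ and $r\ge 2$ be integers, let $1\le i_1,\dots,i_r\le n-2$, and let $t_1=0$ and $0\le t_2,\dots,t_r\le n-1$ be integers. For $1\le s\le r$ let $\mathcal{A}_s=\{A_{s,1},\dots,A_{s,n}\}$ be the family of subsets of $[n]$ given by $$A_{s,\sigma^{t_s}(k)}=[n]\ \text{ if } k\in[i_s]\cup\{n\},\qquad A_{s,\sigma^{t_s}(k)}=[n]\setminus\sigma^{t_s}[i_s]\ \text{ if } k\in[n-1]\setminus[i_s],$$ and let $A_s=\{e_{j_1}+\dots+e_{j_n} : j_k\in A_{s,k},\ 1\le k\le n\}\subset\mathbb{N}^n$. Let $K[A_1\cap\dots\cap A_r]$ be the $K$-subalgebra of the polynomial ring $K[x_1,\dots,x_n]$ generated by the monomials $x^\alpha$ with $\alpha\in A_1\cap\dots\cap A_r$, regarded as a standard graded $K$-algebra in which each generator $x^\alpha$, $\alpha\in A_1\cap\dots\cap A_r$, has degree $1$. Then its $a$-invariant is $$a(K[A_1\cap\dots\cap A_r])=-1.$$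
   Context: $\mathbb{N}=\{0,1,2,\dots\}$ and $[m]=\{1,\dots,m\}$. $\sigma=(1,2,\dots,n)\in S_n$ is the cycle of length $n$ (so $\sigma(k)=k+1$ for $k<n$ and $\sigma(n)=1$), and $\sigma^{t}[i]=\{\sigma^t(1),\dots,\sigma^t(i)\}$. $e_1,\dots,e_n$ is the canonical basis of $\mathbb{R}^n$, and $x^\alpha=x_1^{\alpha_1}\cdots x_n^{\alpha_n}$. All vectors in each $A_s$ have coordinate sum $n$, so the grading is well defined: the degree $i$ component is spanned by the products of $i$ (not necessarily distinct) generators. The $a$-invariant $a(S)$ of a standard graded $K$-algebra $S$ is the degree, as a rational function (degree of numerator minus degree of denominator), of the Hilbert series of $S$. *)

(* Defs.v *)
From mathcomp Require Import all_boot all_fingroup all_algebra.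
From mathcomp Require Import mpoly.

Set Implicit Arguments.
Unset Strict Implicit.
Unset Printing Implicit Defensive.

Import GRing.Theory.
Local Open Scope ring_scope.

(* The element k of [n] = {1, ..., n} is represented by the ordinal k - 1 of
   'I_n; in particular [i] is {k : 'I_n | k < i} and n is the ordinal n.-1. *)
Definition sigma (n : nat) : {perm 'I_n} := perm (@ordS_inj n).

Definition sigma_seg (n t i : nat) : {set 'I_n} :=
  [set (sigma n ^+ t)%g k | k in [set k : 'I_n | (k < i)%N]].

(* The paper prescribes the set of index sigma^t(k) in terms of k, whence the
   inverse permutation here; see [shifted_familyE]. *)
Definition shifted_family (n t i : nat) (j : 'I_n) : {set 'I_n} :=
  let k := (sigma n ^- t)%g j in
  if (k < i)%N || (k.+1 == n) then [set: 'I_n] else ~: sigma_seg n t i.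

Lemma shifted_familyE (n t i : nat) (k : 'I_n) :
  shifted_family t i ((sigma n ^+ t)%g k) =
  if (k < i)%N || (k.+1 == n) then [set: 'I_n] else ~: sigma_seg n t i.
Proof. by rewrite /shifted_family permK. Qed.

Definition transversal_base (n : nat) (A : 'I_n -> {set 'I_n}) :
    {pred 'X_{1..n}} :=
  [pred m : 'X_{1..n} | [exists j : {ffun 'I_n -> 'I_n},
     [forall k, j k \in A k] && (m == \sum_(k < n) U_(j k))%MM]].

Section LinearSpan.
Variables (K : fieldType) (V : lmodType K).

Definition lin_span (X : V -> Prop) (v : V) : Prop :=
  exists2 s : seq (K * V), (forall cv, cv \in s -> X cv.2) &
    v = \sum_(cv <- s) cv.1 *: cv.2.

Definition has_dim (W : V -> Prop) (d : nat) : Prop :=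
  exists b : 'I_d -> V,
    [/\ forall j, W (b j),
        forall c : 'I_d -> K, \sum_j c j *: b j = 0 -> forall j, c j = 0
      & forall v, W v -> exists c : 'I_d -> K, v = \sum_j c j *: b j].

End LinearSpan.

(* A graded K-algebra, given as a subalgebra [gcarrier] of an ambient algebra
   [R] together with its homogeneous components; the laws are in
   [standard_graded]. *)
Record graded_subalg (K : fieldType) (R : comAlgType K) := GradedSubalg {
  gcarrier : R -> Prop;
  gcomp : nat -> R -> Prop }.

Record standard_graded (K : fieldType) (R : comAlgType K)
    (S : graded_subalg R) : Prop := StandardGraded {
  sg_lin : forall i c x y,
    gcomp S i x -> gcomp S i y -> gcomp S i (c *: x + y);
  sg_mul : forall i j x y,
    gcomp S i x -> gcomp S j y -> gcomp S (i + j) (x * y);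
  sg_sum : forall x, gcarrier S x <->
    exists N (f : 'I_N -> R), (forall i : 'I_N, gcomp S i (f i)) /\ x = \sum_i f i;
  sg_direct : forall N (f : 'I_N -> R), (forall i : 'I_N, gcomp S i (f i)) ->
    \sum_i f i = 0 -> forall i, f i = 0;
  sg_0 : forall x, gcomp S 0 x <-> exists c : K, x = c%:A;
  sg_gen : forall i x, gcomp S i.+1 x -> lin_span
    (fun w => exists y z, [/\ gcomp S 1 y, gcomp S i z & w = y * z]) x;
  sg_fin : exists s : seq R, forall x, gcomp S 1 x -> lin_span (fun y => y \in s) x }.

(* The Hilbert series sum_i H(i) T^i is given by its coefficients H, and its
   rationality sum_i H(i) T^i = P / Q by Q * (sum_i H(i) T^i) = P, read
   coefficientwise. The degree size P - size Q of P / Q is independent of the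
   choice of P and Q; see [is_a_invariant_uniq]. *)
Definition hilbert_function (K : fieldType) (R : comAlgType K)
    (S : graded_subalg R) (H : nat -> nat) : Prop :=
  forall i, has_dim (gcomp S i) (H i).

Definition series_eq_fraction (H : nat -> nat) (P Q : {poly rat}) : Prop :=
  forall k, \sum_(j < k.+1) Q`_j * (H (k - j)%N)%:R = P`_k.

Definition is_a_invariant (K : fieldType) (R : comAlgType K)
    (S : graded_subalg R) (a : int) : Prop :=
  exists (H : nat -> nat) (P Q : {poly rat}),
    [/\ hilbert_function S H, P != 0, Q != 0, series_eq_fraction H P Q
      & a = (size P)%:Z - (size Q)%:Z].

Inductive subalg_generated (K : fieldType) (R : algType K) (G : R -> Prop) :
    R -> Prop :=
  | SubalgGen x of G x : subalg_generated G x
  | SubalgScalar (c : K) : subalg_generated G c%:A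
  | SubalgAdd x y of subalg_generated G x & subalg_generated G y :
      subalg_generated G (x + y)
  | SubalgMul x y of subalg_generated G x & subalg_generated G y :
      subalg_generated G (x * y).

Definition products (R : comNzRingType) (G : R -> Prop) (i : nat) (x : R) :
    Prop :=
  exists2 f : 'I_i -> R, (forall k, G (f k)) & x = \prod_k f k.

Definition monomials (K : fieldType) (n : nat) (A : {pred 'X_{1..n}})
    (p : {mpoly K[n]}) : Prop :=
  exists2 m, m \in A & p = 'X_[m].
Arguments monomials K {n} A p.

(* K[A], the generators x^m, m in A, having degree 1; this is a grading as soon
   as all m in A have the same positive coordinate sum, see
   [monomial_algebra_standard]. *)
Definition monomial_algebra (K : fieldType) (n : nat) (A : {pred 'X_{1..n}}) :
    graded_subalg {mpoly K[n]} :=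
  GradedSubalg (subalg_generated (monomials K A))
    (fun i => lin_span (products (monomials K A) i)).

Section Span.
Variables (K : fieldType) (V : lmodType K).
Implicit Types (X Y : V -> Prop).

Lemma lin_span_sub X x : X x -> lin_span X x.
Proof.
move=> Xx; exists [:: (1, x)]; last by rewrite big_seq1 scale1r.
by move=> cv; rewrite inE => /eqP ->.
Qed.

Lemma lin_span0 X : lin_span X 0.
Proof. by exists [::]; rewrite ?big_nil. Qed.

Lemma lin_spanP X c x y :
  lin_span X x -> lin_span X y -> lin_span X (c *: x + y).
Proof.
case=> s Xs -> [s' Xs' ->].
exists ([seq (c * cv.1, cv.2) | cv <- s] ++ s').
  move=> cv; rewrite mem_cat => /orP[/mapP[cv' /Xs ? ->] //|/Xs' //].
rewrite big_cat big_map scaler_sumr; congr (_ + _).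
by apply: eq_bigr => cv _; rewrite scalerA.
Qed.

Lemma lin_spanZ X c x : lin_span X x -> lin_span X (c *: x).
Proof. by move=> Xx; rewrite -[_ *: _]addr0; apply/lin_spanP/lin_span0. Qed.

Lemma lin_spanD X x y : lin_span X x -> lin_span X y -> lin_span X (x + y).
Proof. by move=> Xx Xy; rewrite -[x]scale1r; apply: lin_spanP. Qed.

Lemma lin_span_ind X (P : V -> Prop) :
    P 0 -> (forall c x y, X x -> P y -> P (c *: x + y)) ->
  forall x, lin_span X x -> P x.
Proof.
move=> P0 PD x [s + ->]; elim: s => [|cv s IHs] Xs; first by rewrite big_nil.
rewrite big_cons; apply: PD; first by apply/Xs/mem_head.
by apply: IHs => cv' s_cv'; apply: Xs; rewrite inE s_cv' orbT.
Qed.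

Lemma has_dim_le (W : V -> Prop) d1 d2 :
  has_dim W d1 -> has_dim W d2 -> (d1 <= d2)%N.
Proof.
case=> b1 [W1 free1 _] [b2 [_ _ gen2]].
have [c cE] : exists c : 'I_d1 -> 'I_d2 -> K,
    forall j, b1 j = \sum_k c j k *: b2 k.
  have /fin_all_exists[c cE] j := gen2 _ (W1 j).
  by exists c.
pose M := \matrix_(j, k) c j k.
suff /eqP <- : row_free M by apply: rank_leq_col.
apply: inj_row_free => v vM0; apply/rowP => j; rewrite mxE.
apply: (free1 (v 0)).
under eq_bigr do rewrite cE scaler_sumr.
rewrite exchange_big big1 // => k _.
under eq_bigr do rewrite scalerA.
rewrite -scaler_suml.
suff -> : \sum_i v 0 i * c i k = (v *m M) 0 k by rewrite vM0 mxE scale0r.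
by rewrite mxE; apply: eq_bigr => i _; rewrite mxE.
Qed.

Lemma has_dim_uniq (W : V -> Prop) d1 d2 :
  has_dim W d1 -> has_dim W d2 -> d1 = d2.
Proof. by move=> h1 h2; apply/anti_leq; rewrite !(has_dim_le h1, has_dim_le h2). Qed.

End Span.

Lemma is_a_invariant_uniq (K : fieldType) (R : comAlgType K)
    (S : graded_subalg R) (a a' : int) :
  is_a_invariant S a -> is_a_invariant S a' -> a = a'.
Proof.
case=> H [P [Q [HH P0 Q0 E ->]]] [H' [P' [Q' [HH' P0' Q0' E' ->]]]].
have eqH i : H' i = H i := has_dim_uniq (HH' i) (HH i).
suff PQ : P * Q' = P' * Q.
  have := congr1 (fun p : {poly rat} => (size p).+1) PQ.
  rewrite !size_mul // !prednK ?addn_gt0 ?size_poly_gt0 ?P0 ?P0' // => e.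
  by apply/eqP; rewrite subr_eq addrAC eq_sym subr_eq -!PoszD e addnC.
apply/polyP => k.
pose h := \poly_(i < k.+1) ((H i)%:R : rat).
have trunc (A B : {poly rat}) : series_eq_fraction H A B ->
    forall i, (i <= k)%N -> (B * h)`_i = A`_i.
  move=> AB i ik; rewrite coefM -AB; apply: eq_bigr => j _.
  by rewrite coef_poly ltnS (leq_trans (leq_subr _ _) ik).
have E'' : series_eq_fraction H P' Q'.
  by move=> i; rewrite -E'; apply: eq_bigr => j _; rewrite eqH.
have eqP1 : (P * Q')`_k = (Q * h * Q')`_k.
  by rewrite !coefM; apply: eq_bigr => j _; rewrite (trunc _ _ E) // -ltnS.
have eqP2 : (P' * Q)`_k = (Q' * h * Q)`_k.
  by rewrite !coefM; apply: eq_bigr => j _; rewrite (trunc _ _ E'') // -ltnS.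
by rewrite eqP1 eqP2 mulrAC [in RHS]mulrAC [Q * Q']mulrC.
Qed.

Section MonomialAlgebra.
Variables (K : fieldType) (n d : nat) (A : {pred 'X_{1..n}}).
Hypotheses (d_gt0 : (0 < d)%N) (A_d : forall m, m \in A -> mdeg m = d).
Let G := monomials K A.
Let C i := lin_span (products G i).

Lemma products_mul i j x y :
  products G i x -> products G j y -> products G (i + j) (x * y).
Proof.
case=> f Gf -> [g Gg ->].
exists (fun k => match split k with inl a => f a | inr b => g b end).
  by move=> k; case: (split k).
rewrite big_split_ord; congr (_ * _); apply: eq_bigr => k _.
  by rewrite -[lshift _ _]/(unsplit (inl k)) unsplitK.
by rewrite -[rshift _ _]/(unsplit (inr k)) unsplitK.
Qed.

Lemma products_gen x : G x -> products G 1 x.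
Proof. by move=> Gx; exists (fun=> x); rewrite ?big_ord1. Qed.

Lemma comp_mul i j x y : C i x -> C j y -> C (i + j)%N (x * y).
Proof.
move=> Cx Cy; move: x Cx; apply: lin_span_ind => [|c x x' Px IH].
  by rewrite mul0r; apply: lin_span0.
rewrite mulrDl -scalerAl; apply: lin_spanP => //.
move: y Cy {IH}; apply: lin_span_ind => [|c' y y' Py IH].
  by rewrite mulr0; apply: lin_span0.
rewrite mulrDr -scalerAr; apply: lin_spanP => //.
exact/lin_span_sub/products_mul.
Qed.

Lemma comp_homog i x : C i x -> x \is (d * i).-homog.
Proof.
move: x; apply: lin_span_ind => [|c x y [f Gf ->] hy]; first exact: rpred0.
apply: rpredD => //; apply: rpredZ; elim: i f Gf {y hy} => [|i IHi] f Gf.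
  by rewrite big_ord0 muln0 dhomog1.
rewrite big_ord_recl mulnS; apply: dhomogM; last exact: IHi.
by have [m /A_d <- ->] := Gf ord0; rewrite dhomogX.
Qed.

Lemma comp0 x : C 0 x <-> exists c : K, x = c%:A.
Proof.
split=> [|[c ->]]; last first.
  by apply/lin_spanZ/lin_span_sub; exists (fun=> 1) => [[]|]; rewrite ?big_ord0.
move: x; apply: lin_span_ind => [|c x y [f _ ->] [c' ->]].
  by exists 0; rewrite scale0r.
by exists (c + c'); rewrite big_ord0 scalerDl.
Qed.

Let graded_sum (x : {mpoly K[n]}) : Prop :=
  exists N (f : 'I_N -> {mpoly K[n]}),
    (forall i : 'I_N, C i (f i)) /\ x = \sum_i f i.

Lemma graded_sumP x : graded_sum x <-> exists N (f : nat -> {mpoly K[n]}),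
  (forall i, C i (f i)) /\ forall M, (N <= M)%N -> x = \sum_(i < M) f i.
Proof.
split=> [[N [f [Cf ->]]]|[N [f [Cf xE]]]]; last first.
  by exists N, (fun i => f i); split=> //; apply: xE.
pose g i := if insub i is Some j then f j else 0.
exists N, g; split=> [i|M leNM].
  by rewrite /g; case: insubP => [j _ <-|_]; [apply: Cf | apply: lin_span0].
transitivity (\sum_(i < N) g i).
  by apply: eq_bigr => j _; rewrite /g valK.
rewrite (big_ord_widen M g leNM) big_mkcond; apply: eq_bigr => i _.
by case: ifPn => // iN; rewrite /g insubN.
Qed.

Lemma graded_sumD x y : graded_sum x -> graded_sum y -> graded_sum (x + y).
Proof.
move=> /graded_sumP[N [f [Cf xE]]] /graded_sumP[N' [g [Cg yE]]].
apply/graded_sumP; exists (maxn N N'), (fun i => f i + g i).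
split=> [i|M]; first exact: lin_spanD (Cf i) (Cg i).
rewrite geq_max => /andP[NM N'M].
by rewrite (xE _ NM) (yE _ N'M) big_split.
Qed.

Lemma graded_sum_comp i x : C i x -> graded_sum x.
Proof.
move=> Cx; exists i.+1, (fun j => if j == ord_max then x else 0); split.
  by move=> j; case: eqP => [->|_] //; apply: lin_span0.
by rewrite -big_mkcond big_pred1_eq.
Qed.

Lemma graded_sum_big I (r : seq I) (F : I -> {mpoly K[n]}) :
  (forall i, graded_sum (F i)) -> graded_sum (\sum_(i <- r) F i).
Proof.
move=> gF; elim: r => [|i r IHr]; last by rewrite big_cons; apply: graded_sumD.
by rewrite big_nil; apply: (@graded_sum_comp 0); apply: lin_span0.
Qed.

Lemma graded_sumM x y : graded_sum x -> graded_sum y -> graded_sum (x * y).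
Proof.
move=> [N [f [Cf ->]]] [N' [g [Cg ->]]].
rewrite mulr_suml; apply: graded_sum_big => i.
rewrite mulr_sumr; apply: graded_sum_big => j.
exact: graded_sum_comp (comp_mul (Cf i) (Cg j)).
Qed.

Lemma comp_subalg i x : C i x -> subalg_generated G x.
Proof.
have s0 : subalg_generated G 0.
  by rewrite -(scale0r 1); apply: SubalgScalar.
move: x; apply: lin_span_ind => // c x y [f Gf ->] Sy.
apply: SubalgAdd => //; rewrite -mulr_algl.
apply: SubalgMul; first exact: SubalgScalar.
elim/big_ind: _ => [|u v|k _]; last exact/SubalgGen/Gf.
- by rewrite -(scale1r 1); apply: SubalgScalar.
- exact: SubalgMul.
Qed.

Lemma monomial_algebra_standard : standard_graded (monomial_algebra K A).
Proof.
split=> /=.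
- by move=> i c x y; apply: lin_spanP.
- exact: comp_mul.
- move=> x; split=> [|[N [f [Cf ->]]]].
    elim=> {x} [x Gx|c|x y _ gx _ gy|x y _ gx _ gy].
    + exact/(@graded_sum_comp 1)/lin_span_sub/products_gen.
    + by apply: (@graded_sum_comp 0); apply/comp0; exists c.
    + exact: graded_sumD.
    + exact: graded_sumM.
  elim/big_ind: _ => [|u v|i _]; first by rewrite -(scale0r 1); constructor.
    exact: SubalgAdd.
  exact: comp_subalg (Cf i).
- move=> N f Cf f0 i; apply/mpolyP => m; rewrite mcoeff0.
  have [dm|dm] := eqVneq (mdeg m) (d * i)%N; last first.
    exact: dhomog_nemf_coeff (comp_homog (Cf i)) dm.
  have := congr1 (mcoeff m) f0.
  rewrite raddf_sum mcoeff0 (bigD1 i) //= big1 ?addr0 // => j ji.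
  apply: dhomog_nemf_coeff (comp_homog (Cf j)) _.
  by rewrite /= dm eqn_pmul2l // eq_sym.
- exact: comp0.
- move=> i; apply: lin_span_ind => [|c x y [f Gf ->] IH]; first by apply: lin_span0.
  apply: lin_spanP => //; apply: lin_span_sub; rewrite big_ord_recl.
  exists (f ord0), (\prod_(k < i) f (lift ord0 k)).
  split=> //; apply: lin_span_sub; first exact/products_gen/Gf.
  by exists (fun k => f (lift ord0 k)).
- exists [seq 'X_[bmnm m] | m : 'X_{1..n < d.+1}].
  apply: lin_span_ind => [|c x y [f Gf ->] IH]; first by apply: lin_span0.
  apply: lin_spanP => //; apply: lin_span_sub; rewrite big_ord1.
  have [m Am ->] := Gf ord0.
  have md : (mdeg m < d.+1)%N by rewrite A_d.
  by apply/mapP; exists (BMultinom md); rewrite ?mem_enum.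
Qed.

End MonomialAlgebra.

Lemma mdeg_transversal_base (n : nat) (A : 'I_n -> {set 'I_n}) m :
  m \in transversal_base A -> mdeg m = n.
Proof.
case/existsP=> j /andP[_ /eqP ->]; rewrite mdeg_sum.
by rewrite (eq_bigr (fun=> 1%N)) ?sum1_card ?card_ord // => k _; rewrite mdeg1.
Qed.

(* Main.v *)
(* Substituting z_j = (m_1 + ... + m_j) - k j, with j read modulo n, turns a sum
   of k elements of A_1 /\ ... /\ A_r into an integral point z, z_0 = 0, of the
   k-th dilate of {z : z_b - z_a <= 1 for (a, b) in E}; here E collects the pairs
   (j + 1, j), which encode m >= 0, and the end points of the cyclic intervals
   sigma^(t_s)[i_s].  Such difference constraints survive taking floors, so every
   point of the k-th dilate is a sum of k points of the first one, and the
   Hilbert function counts the points of the dilates.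

   Cut the polytope into alcoves by the hyperplanes z_b - z_a in Z.  Moving
   every point slightly towards a generic point near the interior lattice point
   0 makes the closed polytope a disjoint union of half-open alcoves, that is, of
   half-open unimodular simplices; one that lacks e of its n facets contributes
   T^e / (1 - T)^n to the Hilbert series.  No alcove lacks all its facets, while
   the alcove opposite to the generic point with respect to 0 lacks n - 1 of
   them.  As all coefficients are nonnegative, the numerator has degree n - 1. *)
Require Import Defs.
From mathcomp Require Import all_boot all_order all_fingroup all_algebra.
From mathcomp Require Import mpoly zify.
Set Implicit Arguments.
Unset Strict Implicit.
Unset Printing Implicit Defensive.
Import Order.TTheory GRing.Theory Num.Theory.
Local Open Scope ring_scope.

(** * Rational generating series *)

(** Coefficient [k] of the product involves only the coefficients of the series up to [k], so a
    polynomial truncation may stand in for the series. *)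
Lemma series_eq_fractionE (H : nat -> nat) (P Q : {poly rat}) :
  series_eq_fraction H P Q <->
  forall (h : {poly rat}) k, (forall i, (i <= k)%N -> h`_i = (H i)%:R) -> (Q * h)`_k = P`_k.
Proof.
split=> [HPQ h k hH|hPQ k]; last first.
  rewrite -(hPQ (\poly_(i < k.+1) (H i)%:R)) => [|i ik]; last first.
    by rewrite coef_poly ltnS ik.
  by rewrite coefM; apply: eq_bigr => j _; rewrite coef_poly ltnS leq_subr.
rewrite -HPQ coefM; apply: eq_bigr => j _.
by rewrite hH // leq_subr.
Qed.

Lemma series_eq_fraction_sum (I : Type) (r : seq I) (H : I -> nat -> nat)
    (P : I -> {poly rat}) Q :
  (forall i, series_eq_fraction (H i) (P i) Q) ->
  series_eq_fraction (fun k => \sum_(i <- r) H i k)%N (\sum_(i <- r) P i) Q.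
Proof.
move=> HPQ k; rewrite coef_sum.
under [RHS]eq_bigr do rewrite -HPQ.
rewrite exchange_big; apply: eq_bigr => j _.
by rewrite natr_sum mulr_sumr.
Qed.

Lemma coef_mul_le (Q h h' : {poly rat}) k :
  (forall i, (i <= k)%N -> h`_i = h'`_i) -> (Q * h)`_k = (Q * h')`_k.
Proof.
move=> hh; rewrite !coefM; apply: eq_bigr => j _.
by rewrite hh // leq_subr.
Qed.

(** This is multiplication of the series by $T^d/(1-T)$: the shifted partial sums telescope under
    $1-T$. *)
Lemma series_eq_fraction_psum (H : nat -> nat) (d : nat) (P Q : {poly rat}) :
  series_eq_fraction H P Q ->
  series_eq_fraction (fun k => \sum_(i <- iota d (k.+1 - d)) H (k - i)%N)%N
    ('X^d * P) ((1 - 'X) * Q).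
Proof.
move=> /series_eq_fractionE HPQ; apply/series_eq_fractionE => h k hH.
pose u := \poly_(i < k.+1) ((H i)%:R : rat).
have psumE j : (\sum_(i <- iota d (j.+1 - d)) H (j - i)%N =
                \sum_(i < j.+1 - d) H i)%N.
  rewrite -/(index_iota d j.+1) big_nat_rev -[d in LHS]add0n big_addn big_mkord.
  by apply: eq_bigr => i _; congr (H _); have := ltn_ord i; lia.
have -> : (1 - 'X) * Q * h = Q * ((1 - 'X) * h) by rewrite mulrAC mulrC.
rewrite (@coef_mul_le _ _ ('X^d * u)) => [|i ik]; last first.
  rewrite mulrBl mul1r coefB coefXM coefXnM coef_poly.
  rewrite hH // psumE; case: i ik => [|i] ik /=.
    case: d {HPQ hH psumE} => [|d] /=; last by rewrite subSS sub0n big_ord0 subr0.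
    by rewrite subn0 big_ord1 subr0.
  rewrite hH ?(ltnW ik) // psumE.
  have [id|di] := ltnP i.+1 d.
    have -> : (i.+2 - d = 0)%N by lia.
    have -> : (i.+1 - d = 0)%N by lia.
    by rewrite !big_ord0 subr0.
  rewrite subSn // big_ord_recr /= natrD addrC addKr.
  by case: ifP => //; lia.
rewrite mulrCA !coefXnM; case: ltnP => // dk.
apply: HPQ => i ik; rewrite coef_poly; case: ifP => //; lia.
Qed.

(** For a 0/1 vector [d] these are the barycentric coordinates of the lattice points in the [k]-th
    dilate of a unimodular simplex that lacks the facets marked by 1. *)
Fixpoint bounded_compositions (d : seq nat) (k : nat) : seq (seq nat) :=
  if d is d0 :: d' then
    [seq i :: c | i <- iota d0 (k.+1 - d0), c <- bounded_compositions d' (k - i)]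
  else if k == 0%N then [:: [::]] else [::].

Lemma mem_bounded_compositions d k c :
  (c \in bounded_compositions d k) =
  [&& size c == size d, sumn c == k & all2 leq d c].
Proof.
elim: d k c => [|d0 d IHd] k c /=.
  by case: c => [|i c]; case: k.
apply/allpairsPdep/idP => [[i [c' [+ + ->]]]|].
  rewrite mem_iota IHd /= eqSS => h /and3P[-> /eqP -> ->].
  lia.
case: c => [|i c] //=; rewrite eqSS => /and3P[/eqP sc /eqP sk /andP[d0i dc]].
exists i, c; split=> //; first by rewrite mem_iota; lia.
by rewrite IHd sc dc eqxx; lia.
Qed.

Lemma uniq_bounded_compositions d k : uniq (bounded_compositions d k).
Proof.
elim: d k => [|d0 d IHd] k /=; first by case: k.
apply: allpairs_uniq_dep; first exact: iota_uniq.
  by move=> i _; apply: IHd.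
by move=> [i c] [i' c'] _ _ /= [-> ->].
Qed.

(** Each entry contributes a factor $T^{d_p}/(1-T)$; the empty vector gives the constant series
    1. *)
Lemma bounded_compositions_series d :
  series_eq_fraction (fun k => size (bounded_compositions d k))
    'X^(sumn d) ((1 - 'X) ^+ size d).
Proof.
elim: d => [|d0 d IHd] /=.
  move=> k; rewrite expr0 coefXn.
  rewrite (bigD1 ord0) //= subn0 coefC eqxx mul1r big1 ?addr0.
    by case: (k == 0)%N.
  by move=> j j0; rewrite coefC -[_ == _]/(j == ord0) (negPf j0) mul0r.
rewrite exprD exprS => k; rewrite -(series_eq_fraction_psum d0 IHd).
by apply: eq_bigr => j _; rewrite size_allpairs_dep sumnE big_map.
Qed.

(** * Sorting permutations and partial sums *)

Lemma card_ord_lt n p : (p <= n)%N -> #|[set q : 'I_n | (q < p)%N]| = p.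
Proof.
move=> pn; rewrite cardsE -sum1_card -(big_ord_widen n (fun=> 1%N) pn).
by rewrite sum1_card card_ord.
Qed.

Lemma card_perm_lt n (s : {perm 'I_n}) j :
  #|[set i | (s i < s j)%N]| = s j.
Proof.
rewrite -[RHS](@card_ord_lt n) ?(ltnW (ltn_ord _)) //.
rewrite -[RHS](card_preimset _ (@perm_inj _ s)).
by apply: eq_card => i; rewrite !inE.
Qed.

Lemma perm_eq_of_lt n (s t : {perm 'I_n}) :
  (forall i j, (s i < s j)%N = (t i < t j)%N) -> s = t.
Proof.
move=> st; apply/permP => j; apply: val_inj.
rewrite /= -card_perm_lt -[RHS]card_perm_lt.
by apply: eq_card => i; rewrite !inE st.
Qed.

(** The place of [j] is the number of indices with a smaller key. *)
Lemma sorting_perm n (key : 'I_n -> nat) :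
  injective key -> exists s : {perm 'I_n},
    forall i j, (s i < s j)%N = (key i < key j)%N.
Proof.
move=> key_inj; pose below j := [set i | (key i < key j)%N].
have below_lt j : (#|below j| < n)%N.
  rewrite -[X in (_ < X)%N]card_ord -cardsT proper_card // properE subsetT /=.
  by apply/subsetPn; exists j; rewrite ?inE // ltnn.
pose f j := Ordinal (below_lt j).
have f_homo i j : (key i < key j)%N -> (f i < f j)%N.
  move=> kij; apply/proper_card/properP; split.
    by apply/subsetP => l; rewrite !inE => /ltn_trans; apply.
  by exists i; rewrite !inE ?ltnn.
have f_inj : injective f.
  move=> i j fij; apply: key_inj; apply/eqP; case: ltngtP => // /f_homo.
    by rewrite fij ltnn.
  by rewrite fij ltnn.
exists (perm f_inj) => i j; rewrite !permE.
have [/f_homo //|/f_homo|/key_inj ->] := ltngtP (key i) (key j).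
  by move/ltnW; rewrite leqNgt => /negbTE.
by rewrite ltnn.
Qed.

Lemma homo_ltn_bounded (f : nat -> nat) n :
  (forall p, (p < n)%N -> (f p < f p.+1)%N) ->
  forall p q, (p < q <= n)%N -> (f p < f q)%N.
Proof.
move=> f_lt p q; elim: q => [|q IHq] /andP[] // + qn.
rewrite ltnS leq_eqVlt => /orP[/eqP ->|pq]; first exact: f_lt.
by apply: ltn_trans (f_lt q qn); apply: IHq; rewrite pq ltnW.
Qed.

Lemma sumn_take_next c p : (sumn (take p.+1 c) = sumn (take p c) + nth 0 c p)%N.
Proof.
have [pc|cp] := ltnP p (size c); first by rewrite (take_nth 0%N) // sumn_rcons.
by rewrite nth_default // !take_oversize ?addn0 // ltnW.
Qed.

(** * Half-open alcoves *)

Section Alcoves.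
Variable n' : nat.
Local Notation n := n'.+1.
Implicit Types (z : {ffun 'I_n -> int}) (E : rel 'I_n) (k : nat) (c : seq nat).

Definition dilate E k z : bool :=
  (z ord0 == 0) && [forall a, forall b, E a b ==> (z b - z a <= k%:Z)].

Lemma dilateP E k z :
  reflect (z ord0 = 0 /\ forall a b, E a b -> z b - z a <= k%:Z)
    (dilate E k z).
Proof.
apply: (iffP andP) => [[/eqP z0 /forallP zE]|[-> zE]].
  by split=> // a b; have /forallP/(_ b)/implyP := zE a; apply.
split=> //; apply/forallP => a; apply/forallP => b; apply/implyP; exact: zE.
Qed.

(* [(Q, s)] stands for the points [z = k q + r] with [q = Q - n], [0 <= r <= k]
   and the entries of [r] weakly increasing in the order of places [s]. *)
Definition alcove := ({ffun 'I_n -> 'I_(n + n).+1} * {perm 'I_n})%type.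
Implicit Type A : alcove.

Definition place A : {perm 'I_n} := A.2.

Definition alt A j : int := (A.1 j)%:Z - n%:Z.
(* A perturbed point is [(1 - eps) z / k + eps * eta * j] with [eta] small, so
   that ties [r_a = r_b] are broken by the lexicographic order of [(- q_j, j)],
   encoded here as the number [(n - q_j) * n + j]. The end marker stands for the
   coordinate 0 shifted by one period, of key [(1, 0)]. *)
Definition rank A j : nat := ((n + n - A.1 j) * n + j)%N.
Definition rank_end : nat := (n.+1 * n)%N.
Definition rank_at A p : nat :=
  if insub p is Some q then rank A ((place A^-1)%g q) else rank_end.
(* The facets that the half-open alcove lacks. *)
Definition descents A : seq nat :=
  mkseq (fun p => nat_of_bool (rank_at A p.+1 < rank_at A p)%N) n.
Definition based A := (A.1 ord0 == n :> nat) && (place A ord0 == ord0).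
(** The constraint of [E a b] holds on the whole alcove if $q_b\le q_a$, or if $q_b=q_a+1$ and the
    order of places forces $r_b\le r_a$. *)
Definition admissible E A :=
  based A && [forall a, forall b, E a b ==>
    ((A.1 b <= A.1 a)%N || ((A.1 b == (A.1 a).+1 :> nat) && (place A b < place A a)%N))].
Definition height A c j := sumn (take (place A j) c).
Definition alcove_point k A c : {ffun 'I_n -> int} :=
  [ffun j => k%:Z * alt A j + (height A c j)%:Z].

(** [M] exceeds every rank, so comparing values of [key_at] compares the pairs (partial sum, rank)
    lexicographically. *)
Let M := ((n + n).+1 * n)%N.
Let key_at A c p := (sumn (take p c) * M + rank_at A p)%N.

Lemma rank_at_perm A j : rank_at A (place A j) = rank A j.
Proof. by rewrite /rank_at valK permK. Qed.

Lemma rank_at_end A : rank_at A n = rank_end.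
Proof. by rewrite /rank_at insubN // ltnn. Qed.

Lemma rank_lt A j : (rank A j < M)%N.
Proof. by rewrite /rank /M; have := ltn_ord j; nia. Qed.

Lemma rank_at_lt A p : (rank_at A p < M)%N.
Proof.
rewrite /rank_at; case: insub => [q|]; first exact: rank_lt.
by rewrite /rank_end /M; nia.
Qed.

Lemma rank_inj A : injective (rank A).
Proof.
move=> i j /(congr1 (modn^~ n)).
by rewrite /rank !modnMDl !modn_small // => /val_inj.
Qed.

Lemma rank_alt A i j : (rank A i <= rank A j)%N -> alt A j <= alt A i.
Proof.
rewrite /rank /alt; have := ltn_ord i; have := ltn_ord j.
have := ltn_ord (A.1 i); have := ltn_ord (A.1 j); nia.
Qed.

(** Distinct indices have distinct ranks, and the end marker could tie only with index 0 at
    $q_0=-1$, which [based] excludes. *)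
Lemma rank_at_neq A p : based A -> (p < n)%N -> rank_at A p != rank_at A p.+1.
Proof.
move=> /andP[/eqP A0 _] pn; rewrite /rank_at insubT.
case: insubP => [q _ qE|_].
  rewrite (inj_eq (@rank_inj A)) (inj_eq perm_inj).
  by rewrite -val_eqE /= qE neq_ltn ltnSn.
set j := fun_of_perm _ _; apply/eqP => e.
have /eqP j0 : (j == 0 :> nat)%N.
  have := congr1 (modn^~ n) e.
  by rewrite /rank /rank_end modnMDl modnMl modn_small // => ->.
move: e; have -> : j = ord0 by apply: val_inj.
by rewrite /rank /rank_end A0 addnK addn0 /=; nia.
Qed.

Lemma mem_descents A k c : based A ->
  (c \in bounded_compositions (descents A) k) =
  [&& size c == n, sumn c == k & [forall p : 'I_n, key_at A c p < key_at A c p.+1]%N].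
Proof.
move=> bA; rewrite mem_bounded_compositions size_mkseq.
case: eqP => // sc; rewrite !andTb; case: eqP => // _; rewrite !andTb.
rewrite all2E size_mkseq sc eqxx andTb.
have keyE p : (p < n)%N -> (key_at A c p < key_at A c p.+1)%N =
    ((rank_at A p.+1 < rank_at A p)%N <= nth 0 c p)%N.
  move=> pn; rewrite /key_at sumn_take_next.
  have r2 := rank_at_lt A p; have := rank_at_neq bA pn.
  rewrite mulnDl -addnA ltn_add2l.
  case: (ltngtP (rank_at A p.+1)) => //= r1 _; last by rewrite leq0n ltn_addl.
  case: posnP => [->|c_gt0]; first by rewrite mul0n add0n ltnNge ltnW.
  by apply: leq_trans r2 _; rewrite (leq_trans (leq_pmull M c_gt0)) ?leq_addr.
apply/allP/forallP => [H p|H [d x] /(nthP (0, 0)%N)[p]].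
  rewrite keyE //.
  have := H (nth (0, 0)%N (zip (descents A) c) p).
  rewrite mem_nth ?size_zip ?size_mkseq ?sc ?minnn //.
  by rewrite nth_zip ?size_mkseq // nth_mkseq //=; apply.
rewrite size_zip size_mkseq sc minnn => pn.
rewrite nth_zip ?size_mkseq // nth_mkseq // => -[<- <-].
by have := H (Ordinal pn); rewrite keyE.
Qed.

Section Fiber.
Variables (A : alcove) (k : nat) (c : seq nat).
Hypotheses (bA : based A) (cA : c \in bounded_compositions (descents A) k).

Let key j := (height A c j * M + rank A j)%N.

Let sumn_c : sumn c = k.
Proof. by move: cA; rewrite mem_descents // => /and3P[_ /eqP]. Qed.

Let size_c : size c = n.
Proof. by move: cA; rewrite mem_descents // => /and3P[/eqP]. Qed.

Let key_at_lt p q : (p < q <= n)%N -> (key_at A c p < key_at A c q)%N.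
Proof.
apply: homo_ltn_bounded => {}p pn.
move: cA; rewrite mem_descents // => /and3P[_ _ /forallP].
by move=> /(_ (Ordinal pn)).
Qed.

Let key_atE j : key_at A c (place A j) = key j.
Proof. by rewrite /key_at rank_at_perm. Qed.

Lemma key_lt_perm i j : (place A i < place A j)%N = (key i < key j)%N.
Proof.
have lt_key i' j' : (place A i' < place A j')%N -> (key i' < key j')%N.
  by rewrite -!key_atE => ij; apply: key_at_lt; rewrite ij ltnW.
have [/lt_key //|/lt_key|/val_inj/perm_inj ->] := ltngtP (place A i) (place A j).
  by move/ltnW; rewrite leqNgt => /negbTE.
by rewrite ltnn.
Qed.

Lemma height_le j : (height A c j <= k)%N.
Proof.
by rewrite /height -sumn_c -{2}(cat_take_drop (place A j) c) sumn_cat leq_addr.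
Qed.

(** A remainder [k] ties with the end marker, and preceding its key $(1,0)$ means $-q_j<1$. *)
Lemma height_top j : height A c j = k -> 0 <= alt A j.
Proof.
move=> hk; have : (key_at A c (place A j) < key_at A c n)%N.
  by apply: key_at_lt; rewrite ltn_ord leqnn.
rewrite key_atE /key_at /key hk rank_at_end -size_c take_size sumn_c.
rewrite ltn_add2l /rank /rank_end /alt.
have := ltn_ord j; have := ltn_ord (A.1 j); nia.
Qed.

Lemma alt0 : alt A ord0 = 0.
Proof. by rewrite /alt; case/andP: bA => /eqP -> _; rewrite subrr. Qed.

Lemma height0 : height A c ord0 = 0%N.
Proof. by rewrite /height; case/andP: bA => _ /eqP ->; rewrite take0. Qed.

(** A remainder 0 ties with index 0, which comes first; the tie rule then gives $-q_j\ge 0$. *)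
Lemma height_bottom j : height A c j = 0%N -> alt A j <= 0.
Proof.
move=> h0; have [->|j0] := eqVneq j ord0; first by rewrite alt0.
have : (place A ord0 < place A j)%N.
  case/andP: bA => _ /eqP A0; rewrite A0 lt0n.
  apply: contra j0 => /eqP j0; apply/eqP/(@perm_inj _ (place A)).
  by rewrite A0; apply: val_inj.
rewrite key_lt_perm /key h0 height0 !mul0n !add0n => /ltnW/rank_alt.
by rewrite alt0.
Qed.

End Fiber.

(** Disjointness of the half-open alcoves. Two different quotients for one coordinate force the
    remainders 0 and [k], the larger quotient having remainder 0; the sign conditions for these
    remainders contradict that. Equal quotients and remainders then fix the order of places and the
    gaps. *)
Lemma alcove_point_inj k A A' c c' : based A -> based A' ->
  c \in bounded_compositions (descents A) k ->
  c' \in bounded_compositions (descents A') k ->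
  alcove_point k A c = alcove_point k A' c' -> A = A' /\ c = c'.
Proof.
move=> bA bA' cA cA' /ffunP e.
have alt_le B B' d d' : based B -> based B' ->
    d \in bounded_compositions (descents B) k ->
    d' \in bounded_compositions (descents B') k ->
    (forall j, alcove_point k B d j = alcove_point k B' d' j) ->
    forall j, alt B j <= alt B' j.
  move=> bB bB' dB dB' {}e j; have := e j; rewrite !ffunE => {}e.
  rewrite leNgt; apply/negP => lt_alt.
  have h1 := height_le bB dB j; have h2 := height_le bB' dB' j.
  have e1 : height B d j = 0%N by nia.
  have e2 : height B' d' j = k by nia.
  have := height_bottom bB dB e1; have := height_top bB' dB' e2; lia.
have altE j : alt A j = alt A' j.
  by apply/le_anti; rewrite (alt_le _ _ _ _ _ _ cA cA') ?(alt_le _ _ _ _ _ _ cA' cA).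
have A1 : A.1 = A'.1.
  by apply/ffunP => j; apply: val_inj; have := altE j; rewrite /alt /=; lia.
have hE j : height A c j = height A' c' j.
  by have := e j; rewrite !ffunE altE; lia.
have A2 : A.2 = A'.2.
  apply: perm_eq_of_lt => i j.
  rewrite (key_lt_perm bA cA) (key_lt_perm bA' cA') !hE.
  by rewrite /rank A1.
have AE : A = A' by rewrite (surjective_pairing A) A1 A2 -surjective_pairing.
split=> //; subst A'.
move: (cA) (cA'); rewrite !mem_descents //.
case/and3P=> /eqP sc /eqP kc _ /and3P[/eqP sc' /eqP kc' _].
have takeE p : (p <= n)%N -> sumn (take p c) = sumn (take p c').
  rewrite leq_eqVlt => /orP[/eqP ->|pn].
    by rewrite -{1}sc -sc' !take_size kc kc'.
  by have := hE ((place A^-1)%g (Ordinal pn)); rewrite /height permKV.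
apply: (@eq_from_nth _ 0%N); first by rewrite sc sc'.
move=> p; rewrite sc => pn; have := takeE p.+1 pn.
by rewrite !sumn_take_next takeE ?(ltnW pn) //; lia.
Qed.

Lemma alcove_point_dilate E k A c : admissible E A ->
  c \in bounded_compositions (descents A) k -> dilate E k (alcove_point k A c).
Proof.
case/andP=> bA /forallP EA cA; apply/dilateP; split=> [|a b Eab].
  by rewrite ffunE alt0 // height0 // mulr0.
rewrite !ffunE; have ha := height_le bA cA a; have hb := height_le bA cA b.
have /forallP/(_ b)/implyP/(_ Eab) := EA a.
case/orP=> [ab|/andP[/eqP ab]]; first by rewrite /alt; nia.
rewrite (key_lt_perm bA cA) /alt ab => key_ab.
have : (height A c b <= height A c a)%N.
  by have := rank_lt A b; have := rank_lt A a; nia.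
nia.
Qed.

(** For $k>0$ the remainder of a positive [x] is taken in $[1,k]$, that of any other [x] in
    $[0,k-1]$; this settles the ambiguous multiples of [k] as the perturbation towards 0 does. *)
Lemma floor_toward0 (x : int) k : `|x| <= k%:Z * n%:Z ->
  exists q : int, exists r : nat,
    [/\ x = k%:Z * q + r%:Z, (r <= k)%N, (r = k -> 0 <= q),
        (r = 0%N -> q <= 0) & `|q| <= n%:Z].
Proof.
case: k => [|k] xk.
  by exists 0, 0%N; split=> //; lia.
pose y := if 0 < x then x - 1 else x.
have y1 := divz_eq y k.+1; have y2 := ltz_pmod y (isT : 0 < k.+1%:Z).
have y3 := modz_ge0 y (isT : k.+1%:Z != 0).
have xy : (0 < x /\ y = x - 1) \/ (x <= 0 /\ y = x).
  by rewrite /y; case: ltP => ?; [left|right].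
exists (y %/ k.+1)%Z; case: xy => -[x0 yx].
  by exists (`|(y %% k.+1)%Z|%N.+1); split; nia.
by exists `|(y %% k.+1)%Z|%N; split; nia.
Qed.

(** Covering by half-open alcoves: round every coordinate, sort the remainders with ties broken by
    rank, and take the gaps between consecutive remainders as [c]. *)
Lemma dilate_alcove_point E k z : (forall j, `|z j| <= k%:Z * n%:Z) ->
  dilate E k z -> exists2 A, admissible E A &
    exists2 c, c \in bounded_compositions (descents A) k & z = alcove_point k A c.
Proof.
move=> z_bound /dilateP[z0 zE].
have /fin_all_exists[q /fin_all_exists[r qrP]] j := floor_toward0 (z_bound j).
have q_bound j : `|q j| <= n%:Z by case: (qrP j).
have r_le j : (r j <= k)%N by case: (qrP j).
have q0 : q ord0 = 0 by case: (qrP ord0); rewrite z0; nia.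
have r0 : r ord0 = 0%N by case: (qrP ord0); rewrite z0 q0; nia.
(* The bound $|q_j|\le n$ makes both the absolute value and [inord] exact. *)
pose A1 : {ffun 'I_n -> 'I_(n + n).+1} := [ffun j => inord `|(q j + n%:Z)%R|%N].
have A1E j : (A1 j : nat) = `|(q j + n%:Z)%R|%N.
  by rewrite ffunE inordK //; have := q_bound j; lia.
clearbody A1; pose rk j := ((n + n - A1 j) * n + j)%N.
have rk_inj : injective rk := @rank_inj (A1, 1%g).
have rk_lt j : (rk j < M)%N := rank_lt (A1, 1%g) j.
have [|s sP] := @sorting_perm n (fun j => r j * M + rk j)%N.
  move=> i j /= /(congr1 (modn^~ M)).
  by rewrite !modnMDl !modn_small // => /rk_inj.
have altE j : alt (A1, s) j = q j.
  by rewrite /alt A1E; have := q_bound j; lia.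
have s0 : s ord0 = ord0.
  apply/eqP; rewrite -val_eqE /= -leqn0 leqNgt; apply/negP => s0.
  have := sP ((s^-1)%g ord0) ord0; rewrite permKV s0 r0 mul0n add0n.
  set j := ((s^-1)%g ord0) => /esym lt_j.
  have := rk_lt ord0; have rj0 : r j = 0%N.
    case: (posnP (r j)) => // r_gt0; move: lt_j; rewrite ltnNge.
    by rewrite (leq_trans (ltnW (rk_lt ord0))) ?(leq_trans (leq_pmull M r_gt0)) ?leq_addr.
  have qj : q j <= 0 by case: (qrP j) => _ _ _ + _; apply.
  move: lt_j; rewrite rj0 mul0n add0n /rk !A1E q0 /=.
  by have := q_bound j; nia.
have bA : based (A1, s) by rewrite /based /= s0 eqxx A1E q0 /=; lia.
(* The sorted remainders; the default [k] at the end marker makes the gaps add up to [k]. *)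
pose rr p := if insub p is Some p' then r ((s^-1)%g p') else k.
have rrE j : rr (s j) = r j by rewrite /rr valK permK.
have rr_end : rr n = k by rewrite /rr insubN // ltnn.
have rr_lt p : (p < n)%N ->
    (rr p * M + rank_at (A1, s) p < rr p.+1 * M + rank_at (A1, s) p.+1)%N.
  move=> pn; rewrite -[p]/(val (Ordinal pn)) -(permKV s (Ordinal pn)).
  set i := fun_of_perm (s^-1)%g _; rewrite rrE (rank_at_perm (A1, s)).
  have := ltn_ord (s i); rewrite leq_eqVlt => /orP[/eqP sn|sn].
    rewrite sn rr_end rank_at_end /rank_end.
    have := r_le i; rewrite leq_eqVlt => /orP[/eqP ri|ri]; last first.
      by have := rk_lt i; rewrite /rk /rank /=; nia.
    have qi : 0 <= q i by case: (qrP i) => _ _ + _ _; apply.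
    by rewrite ri ltn_add2l /rank /= A1E; have := ltn_ord i; nia.
  rewrite -[(s i).+1]/(val (Ordinal sn)) -(permKV s (Ordinal sn)).
  rewrite rrE (rank_at_perm (A1, s)) -/(rk _) -/(rk _).
  by rewrite -sP permKV /=.
have rr_le p : (p < n)%N -> (rr p <= rr p.+1)%N.
  move=> /rr_lt; have := rank_at_lt (A1, s) p.
  by have := rank_at_lt (A1, s) p.+1; nia.
pose c := mkseq (fun p => rr p.+1 - rr p)%N n.
have takeE p : (p <= n)%N -> sumn (take p c) = rr p.
  elim: p => [|p IHp] pn; first by have := rrE ord0; rewrite s0 r0 take0.
  by rewrite sumn_take_next IHp ?(ltnW pn) // nth_mkseq // subnKC ?rr_le.
have cA : c \in bounded_compositions (descents (A1, s)) k.
  have sc : size c = n by rewrite size_mkseq.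
  have kc : sumn c = k by rewrite -rr_end -takeE // -sc take_size.
  rewrite mem_descents // sc kc !eqxx !andTb.
  by apply/forallP => p; rewrite /key_at !takeE ?rr_lt // ltnW.
have hE j : height (A1, s) c j = r j.
  by rewrite /height takeE ?rrE // ltnW.
have zP : z = alcove_point k (A1, s) c.
  by apply/ffunP => j; rewrite ffunE altE hE; case: (qrP j).
exists (A1, s); last by exists c.
rewrite /admissible bA; apply/forallP => a; apply/forallP => b; apply/implyP => Eab.
have := zE a b Eab; rewrite zP !ffunE !hE !altE /= => zab.
have ra := r_le a; have rb := r_le b; have qa := q_bound a; have qb := q_bound b.
rewrite sP !A1E.
have [qab|qab|qab] : [\/ q b <= q a, q b = q a + 1 | q a + 2 <= q b].
- by have [?|?|?] := ltgtP (q b) (q a + 1); [constructor 1|constructor 3|constructor 2]; lia.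
- by apply/orP; left; lia.
- apply/orP; right; apply/andP; split; first by lia.
  have : (r b <= r a)%N by nia.
  rewrite leq_eqVlt => /orP[/eqP ->|rab].
    rewrite ltn_add2l ltnNge; apply/negP => rk_ab.
    by have := @rank_alt (A1, s) a b rk_ab; rewrite !altE; lia.
  apply: (@leq_trans ((r b).+1 * M)%N); first by rewrite mulSn addnC ltn_add2r.
  by rewrite (leq_trans (leq_mul rab (leqnn M))) ?leq_addr.
(* A jump of at least 2 leaves only the remainders 0 and [k], whose sign conditions give $q_b\le
   0\le q_a$, a contradiction. *)
- have rb0 : r b = 0%N by nia.
  have rak : r a = k by nia.
  have qb0 : q b <= 0 by case: (qrP b) => _ _ _ + _; apply.
  have qa0 : 0 <= q a by case: (qrP a) => _ _ + _ _; apply.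
  lia.
Qed.

End Alcoves.

(** * Lattice points of the dilates and the numerator of their series *)

Section Series.
Variables (n' : nat) (E : rel 'I_n'.+1).
Local Notation n := n'.+1.
Hypothesis E_cycle : forall j, E (ordS j) j.
Implicit Types (z : {ffun 'I_n -> int}) (k : nat) (A : alcove n').

Definition dilate_points k : seq {ffun 'I_n -> int} :=
  [seq alcove_point k A c | A <- enum (admissible E),
                            c <- bounded_compositions (descents A) k].

Lemma iter_ordS u : (u <= n)%N -> iter u (@ordS n) ord0 = (u %% n)%N :> nat.
Proof.
elim: u => [|u IHu] un /=; first by rewrite mod0n.
by rewrite IHu ?(ltnW un) // -addn1 modnDml addn1.
Qed.

Lemma iter_ordS_lt (j : 'I_n) : iter j (@ordS n) ord0 = j.
Proof. by apply: val_inj; rewrite /= iter_ordS ?modn_small // ltnW. Qed.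

Lemma iter_ordS_rev (j : 'I_n) : iter (n - j)%N (@ordS n) j = ord0.
Proof.
rewrite -{2}(iter_ordS_lt j) -iterD subnK ?(ltnW (ltn_ord j)) //.
by apply: val_inj; apply: etrans (iter_ordS (leqnn n)) (modnn n).
Qed.

(** Each step along the cycle lowers [z] by at most [k]; walking from 0 to [j] bounds [z j] below,
    walking on from [j] back to 0 bounds it above. *)
Lemma dilate_bound k z : dilate E k z -> forall j, `|z j| <= k%:Z * n%:Z.
Proof.
move=> /dilateP[z0 zE] j.
have walk i u : z i <= z (iter u (@ordS n) i) + k%:Z * u%:Z.
  elim: u => [|u IHu]; first by rewrite mulr0 addr0.
  have := zE _ _ (E_cycle (iter u (@ordS n) i)); rewrite /=; lia.
have := walk ord0 j; have := walk j (n - j)%N.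
rewrite iter_ordS_lt iter_ordS_rev z0; have := ltn_ord j; nia.
Qed.

Lemma mem_dilate_points k z : (z \in dilate_points k) = dilate E k z.
Proof.
apply/allpairsPdep/idP => [[A [c [+ cA ->]]]|zP].
  by rewrite mem_enum => admA; apply: alcove_point_dilate.
have [A admA [c cA ->]] := dilate_alcove_point (dilate_bound zP) zP.
by exists A, c; rewrite mem_enum.
Qed.

Lemma uniq_dilate_points k : uniq (dilate_points k).
Proof.
apply: allpairs_uniq_dep; first exact: enum_uniq.
  by move=> A _; apply: uniq_bounded_compositions.
move=> [A c] [A' c'] /allpairsPdep[B [d [+ dB /= [-> ->]]]].
move=> + /allpairsPdep[B' [d' [+ dB' /= [-> ->]]]].
rewrite !mem_enum => /andP[bB _] /andP[bB' _].
by case/(alcove_point_inj bB bB' dB dB') => -> ->.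
Qed.

(** The numerator of the Ehrhart series of the polytope, one term per half-open alcove. *)
Definition descent_poly : {poly rat} :=
  \sum_(A <- enum (admissible E)) 'X^(sumn (descents A)).

Lemma dilate_points_series :
  series_eq_fraction (size \o dilate_points) descent_poly ((1 - 'X) ^+ n).
Proof.
have := @series_eq_fraction_sum _ (enum (admissible E))
  (fun A k => size (bounded_compositions (descents A) k))
  (fun A => 'X^(sumn (descents A))) ((1 - 'X) ^+ n).
have descs A : series_eq_fraction
    (fun k => size (bounded_compositions (descents A) k))
    'X^(sumn (descents A)) ((1 - 'X) ^+ n).
  by have := bounded_compositions_series (descents A); rewrite size_mkseq.
move=> /(_ descs) HPQ k; rewrite -HPQ; apply: eq_bigr => j _.
by rewrite /= size_allpairs_dep sumnE big_map.
Qed.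

Lemma sumn_descents A :
  sumn (descents A) = (\sum_(p < n) (rank_at A p.+1 < rank_at A p))%N.
Proof. by rewrite sumnE big_map -[iota 0 n]/(index_iota 0 n) big_mkord. Qed.

(** If every step were a descent, the ranks would fall from $n\cdot n$ at index 0 to the larger
    value [rank_end]. *)
Lemma sumn_descents_lt A : admissible E A -> (sumn (descents A) < n)%N.
Proof.
case/andP=> /andP[/eqP A0 /eqP s0] _.
have sum1 : (\sum_(p < n) 1 = n)%N by rewrite sum1_card card_ord.
rewrite sumn_descents -[X in (_ < X)%N]sum1 ltn_neqAle leq_sum ?andbT; last first.
  by move=> p _; case: ltnP.
apply/eqP => all_desc.
have desc p : (p < n)%N -> (rank_at A p.+1 < rank_at A p)%N.
  move=> pn; apply: contraPT all_desc => no_desc.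
  apply/eqP; rewrite neq_ltn; apply/orP; left.
  rewrite (bigD1 (Ordinal pn)) //= (negbTE no_desc) add0n.
  rewrite [X in (_ < X)%N](bigD1 (Ordinal pn)) //= add1n ltnS leq_sum // => q _.
  by case: ltnP.
have chain p : (p <= n)%N -> (rank_at A p <= rank_at A 0)%N.
  elim: p => // p IHp pn; apply: leq_trans (ltnW (desc p pn)) (IHp (ltnW pn)).
have := chain n (leqnn n); have := rank_at_perm A ord0.
by rewrite s0 rank_at_end /rank_end => ->; rewrite /rank A0 /=; nia.
Qed.

(* [q = -1] off 0, with the places in decreasing order: the alcove whose facets
   through the lattice point 0 all face the perturbed origin. *)
Definition opposite_alcove : alcove n' :=
  ([ffun j => if j == ord0 then inord n else inord n'],
   perm (@oppr_inj 'I_n)).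

Lemma opposite_alcove_rank p : (p < n)%N ->
  rank_at opposite_alcove p =
    (if p == 0 then n * n else n.+1 * n + (n - p))%N.
Proof.
move=> pn; pose q := Ordinal pn.
have sV : place opposite_alcove (- q) = q by rewrite permE opprK.
have := rank_at_perm opposite_alcove (- q); rewrite sV /= => ->.
rewrite /rank ffunE oppr_eq0 -val_eqE /=.
case: eqP => [->|/eqP p0]; first by rewrite inordK ?subn0 ?modnn; lia.
rewrite inordK; last by lia.
rewrite modn_small; lia.
Qed.

Lemma opposite_alcove_rank0 : rank_at opposite_alcove 0 = (n * n)%N.
Proof. by rewrite opposite_alcove_rank. Qed.

Lemma opposite_alcove_rankS p : (p < n')%N ->
  rank_at opposite_alcove p.+1 = (n.+1 * n + (n' - p))%N.
Proof. by move=> pn; rewrite opposite_alcove_rank. Qed.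

Lemma opposite_alcove_admissible : admissible E opposite_alcove.
Proof.
apply/andP; split.
  by rewrite /based ffunE eqxx inordK ?eqxx ?permE ?oppr0 ?eqxx //; lia.
apply/forallP => a; apply/forallP => b; apply/implyP => _.
have [->|b0] := eqVneq b ord0; last first.
  rewrite !ffunE (negPf b0); case: ifP => _; rewrite !inordK; lia.
have [->|a0] := eqVneq a ord0; first by rewrite leqnn.
apply/orP; right; rewrite !ffunE eqxx (negPf a0) !permE oppr0 !inordK; try lia.
by rewrite eqxx lt0n -[_ != _]/(- a != 0) oppr_eq0.
Qed.

(** The ranks start at $n\cdot n$, jump above $(n+1)n$ and then decrease by 1 down to [rank_end],
    which is $(n+1)n$: only the first step ascends. *)
Lemma sumn_descents_opposite : sumn (descents opposite_alcove) = n'.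
Proof.
rewrite sumn_descents big_ord_recl opposite_alcove_rank0.
rewrite [X in (X + _)%N](_ : _ = 0%N) ?add0n; last first.
  have [n1|n1] := posnP n'; last by rewrite opposite_alcove_rankS //; nia.
  have -> : rank_at opposite_alcove 1 = rank_end n'.
    by rewrite -(rank_at_end opposite_alcove); congr rank_at; lia.
  by rewrite /rank_end; nia.
rewrite -[RHS]card_ord -sum1_card; apply: eq_bigr => p _.
rewrite lift0 (@opposite_alcove_rankS p) //.
have := ltn_ord p; rewrite leq_eqVlt => /orP[/eqP pn|pn].
  have -> : rank_at opposite_alcove p.+2 = rank_end n'.
    by rewrite -(rank_at_end opposite_alcove) pn.
  by rewrite /rank_end; case: ltnP => //; have := ltn_ord p; lia.
by rewrite opposite_alcove_rankS // ltn_add2l; case: ltnP => //; lia.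
Qed.

Lemma size_descent_poly : size descent_poly = n.
Proof.
apply/eqP; rewrite eqn_leq; apply/andP; split.
  rewrite /descent_poly big_seq; elim/big_ind: _ => [|p q hp hq|A].
  - by rewrite size_poly0.
  - by rewrite (leq_trans (size_polyD p q)) // geq_max hp.
  - by rewrite mem_enum size_polyXn => /sumn_descents_lt.
(* The coefficient of degree [n'] counts alcoves, so the opposite alcove keeps it nonzero. *)
rewrite ltnNge; apply/negP => /leq_sizeP/(_ n' (leqnn _)).
rewrite coef_sum (eq_bigr (fun A => (n' == sumn (descents A))%:R)) => [|A _]; last first.
  by rewrite coefXn.
rewrite -natr_sum => /eqP; rewrite pnatr_eq0 big_enum.
rewrite (bigD1 opposite_alcove) ?[_ \in _]opposite_alcove_admissible //.
by rewrite sumn_descents_opposite eqxx.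
Qed.

End Series.

(** * Hilbert function *)

Lemma has_dim_monomials (K : fieldType) n (X : {mpoly K[n]} -> Prop)
    (s : seq 'X_{1..n}) :
  uniq s -> (forall x, X x <-> exists2 m, m \in s & x = 'X_[m]) ->
  has_dim (lin_span X) (size s).
Proof.
move=> s_uniq XP; pose mon (j : 'I_(size s)) := tnth (in_tuple s) j.
have mon_inj : injective mon.
  exact/(tuple_uniqP (in_tuple s)).
exists (fun j => 'X_[mon j]); split=> [j|c c0 j|v].
- by apply/lin_span_sub/XP; exists (mon j); rewrite ?mem_tnth.
- have := congr1 (mcoeff (mon j)) c0.
  rewrite raddf_sum mcoeff0 (bigD1 j) //= big1 ?addr0 => [|i ij].
    by rewrite mcoeffZ mcoeffX eqxx mulr1.
  by rewrite mcoeffZ mcoeffX (inj_eq mon_inj) (negPf ij) mulr0.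
- move: v; apply: lin_span_ind => [|c x y /XP[m ms ->] [c' ->]].
    by exists (fun=> 0); rewrite big1 // => j _; rewrite scale0r.
  have ix : (index m s < size s)%N by rewrite index_mem.
  exists (fun j => (if j == Ordinal ix then c else 0) + c' j).
  under [RHS]eq_bigr do rewrite scalerDl.
  rewrite big_split /=; congr (_ + _).
  rewrite (bigD1 (Ordinal ix)) //= eqxx big1 ?addr0 => [|j /negPf ->]; last first.
    by rewrite scale0r.
  by rewrite /mon (tnth_nth 0%MM) /= nth_index.
Qed.

Section Exponents.
Variables (n' : nat) (E : rel 'I_n'.+1).
Local Notation n := n'.+1.
Hypothesis E_cycle : forall j, E (ordS j) j.
Implicit Types (z : {ffun 'I_n -> int}) (k : nat).

(** The absolute value only converts to [nat]: on [dilate E k] the cycle constraints make its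
    argument nonnegative. *)
Definition exponent k z : 'X_{1..n} :=
  [multinom `|(k%:Z + z (ordS j) - z j)%R|%N | j < n].

Lemma exponentE k z j : dilate E k z ->
  (exponent k z j)%:Z = k%:Z + z (ordS j) - z j.
Proof. by move=> /dilateP[_ /(_ _ _ (E_cycle j)) zj]; rewrite mnmE; lia. Qed.

Lemma exponent_inj k : {in dilate E k &, injective (exponent k)}.
Proof.
move=> z z' zP zP' e; apply/ffunP => j.
rewrite -(iter_ordS_lt j); elim: (j : nat) => [|u IHu] /=.
  by case/dilateP: zP => -> _; case/dilateP: zP' => ->.
set a := iter u _ _ in IHu *.
have := exponentE a zP; have := exponentE a zP'; rewrite e IHu.
by move=> -> /addIr/addrI ->.
Qed.

Lemma dilate_sum k (zs : 'I_k -> {ffun 'I_n -> int}) :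
  (forall l, dilate E 1 (zs l)) -> dilate E k (\sum_l zs l).
Proof.
move=> zsP; apply/dilateP; split=> [|a b Eab].
  rewrite sum_ffunE big1 // => l _.
  by case/dilateP: (zsP l).
rewrite !sum_ffunE -sumrB; apply: (@le_trans _ _ (\sum_(l < k) 1)).
  by apply: ler_sum => l _; case/dilateP: (zsP l) => _; apply.
by rewrite sumr_const card_ord natz.
Qed.

Lemma exponent_sum k (zs : 'I_k -> {ffun 'I_n -> int}) :
  (forall l, dilate E 1 (zs l)) ->
  exponent k (\sum_l zs l) = (\sum_l exponent 1 (zs l))%MM.
Proof.
move=> zsP; apply/mnmP => j; apply/eqP; rewrite -eqz_nat; apply/eqP.
rewrite exponentE ?dilate_sum // mnm_sumE -[RHS]natz natr_sum.
rewrite (eq_bigr (fun l => 1 + zs l (ordS j) - zs l j)) => [|l _]; last first.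
  by rewrite natz exponentE.
by rewrite sumrB big_split /= sumr_const card_ord natz !sum_ffunE.
Qed.

(* [z] is the sum of the points [floor ((z + k - 1 - l) / k)], [l < k]; floors
   preserve difference constraints with integral bounds. *)
Lemma dilate_decomposition k z : dilate E k z ->
  exists2 zs : 'I_k -> {ffun 'I_n -> int},
    (forall l, dilate E 1 (zs l)) & z = \sum_l zs l.
Proof.
move=> zP; have z_bound := dilate_bound E_cycle zP.
case: (posnP k) => [k0|k_gt0].
  exists (fun=> 0) => [l|]; first by have := ltn_ord l; rewrite {2}k0.
  rewrite big1 //; apply/ffunP => j; rewrite ffunE; have := z_bound j.
  by rewrite k0 mul0r normr_le0 => /eqP.
have {zP} /dilateP[z0 zE] := zP.
pose q j := (z j %/ k)%Z; pose r j := `|(z j %% k)%Z|%N.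
have k_neq0 : k%:Z != 0 by rewrite lt0n_neq0.
have rE j : (r j)%:Z = (z j %% k)%Z by rewrite /r gez0_abs ?modz_ge0.
have zqr j : z j = k%:Z * q j + (r j)%:Z by rewrite rE mulrC -divz_eq.
have r_lt j : (r j < k)%N by rewrite -ltz_nat rE ltz_pmod.
exists (fun l : 'I_k => [ffun j => q j + (l < r j)%N%:Z]) => [l|].
  apply/dilateP; split=> [|a b Eab].
    by rewrite ffunE /q /r z0 div0z mod0z.
  have := zE a b Eab; rewrite !ffunE !zqr; have := r_lt a; have := r_lt b.
  move=> rb ra zab.
  have [qab|qab|qab] : [\/ q b <= q a, q b = q a + 1 | q a + 2 <= q b].
  - by have [?|?|?] := ltgtP (q b) (q a + 1);
      [constructor 1|constructor 3|constructor 2]; lia.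
  - by case: (l < r b)%N; case: (l < r a)%N; lia.
  - have : (r b <= r a)%N by nia.
    by case: ltnP; case: ltnP; lia.
  - by nia.
apply/ffunP => j; rewrite sum_ffunE zqr.
under eq_bigr do rewrite ffunE.
rewrite big_split /= sumr_const card_ord -mulr_natl natz; congr (_ + _).
rewrite -[LHS]natz -{1}(card_ord_lt (ltnW (r_lt j))) -sum1_card natr_sum.
by rewrite big_mkcond; apply: eq_bigr => l _; rewrite inE; case: ltnP.
Qed.

(** One direction adds the points of the factors; the converse is the integer decomposition property
    of the polytope. *)
Lemma products_exponents (K : fieldType) (A : {pred 'X_{1..n}}) k x :
  (forall m, m \in A <-> exists2 z, dilate E 1 z & m = exponent 1 z) ->
  products (monomials K A) k x <->
  exists2 m, m \in [seq exponent k z | z <- dilate_points E k] & x = 'X_[m].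
Proof.
move=> AP.
have mpolyX_sum (f : 'I_k -> 'X_{1..n}) :
    'X_[\sum_l f l] = \prod_l 'X_[f l] :> {mpoly K[n]}.
  by apply: (big_morph (fun m => 'X_[m])); [apply: mpolyXD | apply: mpolyX0].
split=> [[f fA ->]|[m /mapP[z + ->] ->]].
  have zsP l : exists z, dilate E 1 z /\ f l = 'X_[exponent 1 z].
    by have [m /AP[z zP ->] ->] := fA l; exists z.
  have /fin_all_exists[zs zsE] := zsP.
  exists (exponent k (\sum_l zs l)).
    apply: map_f; rewrite mem_dilate_points //; apply: dilate_sum => l.
    by case: (zsE l).
  rewrite exponent_sum => [|l]; last by case: (zsE l).
  by rewrite mpolyX_sum; apply: eq_bigr => l _; case: (zsE l).
rewrite mem_dilate_points // => /dilate_decomposition[zs zsP ->].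
exists (fun l => 'X_[exponent 1 (zs l)]) => [l|].
  by exists (exponent 1 (zs l)) => //; apply/AP; exists (zs l).
by rewrite exponent_sum // mpolyX_sum.
Qed.

Lemma dilate_a_invariant (K : fieldType) (A : {pred 'X_{1..n}}) :
  (forall m, m \in A <-> exists2 z, dilate E 1 z & m = exponent 1 z) ->
  is_a_invariant (monomial_algebra K A) (-1).
Proof.
move=> AP; exists (size \o dilate_points E), (descent_poly E), ((1 - 'X) ^+ n).
have size1X : size (1 - 'X : {poly rat}) = 2%N.
  by rewrite -opprB size_polyN size_XsubC.
have X1 : (1 - 'X : {poly rat}) != 0 by rewrite -size_poly_gt0 size1X.
split.
- move=> k; rewrite /= -(size_map (exponent k)); apply: has_dim_monomials.
    rewrite map_inj_in_uniq ?uniq_dilate_points // => z z'.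
    by rewrite !mem_dilate_points //; apply: exponent_inj.
  by move=> x; apply: products_exponents.
- by rewrite -size_poly_gt0 size_descent_poly.
- exact: expf_neq0.
- exact: dilate_points_series.
(* The sizes are [n] for the numerator and [n.+1] for the denominator. *)
- rewrite size_descent_poly (polySpred (expf_neq0 _ X1)) size_exp size1X mul1n.
  by lia.
Qed.

End Exponents.

(** * Transversal bases of cyclic families *)

Lemma size_flatten_nseq (T : Type) (f : T -> nat) (s : seq T) :
  size (flatten [seq nseq (f x) x | x <- s]) = (\sum_(x <- s) f x)%N.
Proof.
rewrite size_flatten /shape -map_comp sumnE big_map.
by apply: eq_bigr => x _; rewrite /= size_nseq.
Qed.

Lemma count_flatten_nseq (T : eqType) (f : T -> nat) (s : seq T) x :
  uniq s -> x \in s -> count_mem x (flatten [seq nseq (f y) y | y <- s]) = f x.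
Proof.
move=> s_uniq xs; rewrite count_flatten -map_comp sumnE big_map.
rewrite (bigD1_seq x) //= count_nseq /= eqxx mul1n big1 ?addn0 // => y yx.
by rewrite count_nseq /= (negPf yx).
Qed.

(* Hall's condition reduces to a single inequality: list the elements of [m],
   those of [B] first, and serve the unrestricted positions [F] first. *)
Lemma two_valued_transversal_base n (F B : {set 'I_n}) (m : 'X_{1..n}) :
  m \in transversal_base (fun k => if k \in F then [set: 'I_n] else ~: B) <->
  mdeg m = n /\ (\sum_(l in B) m l <= #|F|)%N.
Proof.
split=> [mA|[m_deg m_le]].
  split; first exact: mdeg_transversal_base mA.
  case/existsP: mA => j /andP[/forallP jA /eqP ->].
  under eq_bigr do rewrite mnm_sumE.
  rewrite exchange_big -sum1_card [X in (_ <= X)%N]big_mkcond /=.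
  apply: leq_sum => k _; under eq_bigr do rewrite mnm1E.
  have := jA k; case: ifP => [_ _|_].
    rewrite -big_mkcondr sum1_card.
    by rewrite (leq_trans _ (eq_leq (card1 (j k)))) // subset_leq_card //;
      apply/subsetP => l; rewrite !inE => /andP[_ /eqP ->].
  rewrite inE => jB; rewrite big1 // => l lB.
  by case: eqP => // jl; rewrite jl lB in jB.
pose list (X : {set 'I_n}) := flatten [seq nseq (m l) l | l <- enum X].
pose L := list B ++ list (~: B); pose sl := enum F ++ enum (~: F).
have size_list X : size (list X) = (\sum_(l in X) m l)%N.
  by rewrite size_flatten_nseq big_enum.
have enum_perm (X : {set 'I_n}) : perm_eq (enum X ++ enum (~: X)) (enum 'I_n).
  apply: uniq_perm; rewrite ?enum_uniq //.
    rewrite cat_uniq !enum_uniq andbT /=; apply/hasPn => x.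
    by rewrite !mem_enum inE.
  by move=> x; rewrite mem_cat !mem_enum inE orbN.
have size_L : size L = n.
  rewrite size_cat !size_list -[RHS]m_deg mdegE [RHS](bigID (mem B)) /=.
  by congr (_ + _)%N; apply: eq_bigl => l; rewrite inE.
have size_sl : size sl = n by rewrite (perm_size (enum_perm F)) size_enum_ord.
have sl_uniq : uniq sl by rewrite (perm_uniq (enum_perm F)) enum_uniq.
have mem_sl k : k \in sl by rewrite (perm_mem (enum_perm F)) mem_enum.
apply/existsP; exists [ffun k => nth k L (index k sl)].
apply/andP; split.
  apply/forallP => k; rewrite ffunE; case: ifP => [_|kF]; first by rewrite inE.
  (* A position outside [F] has index at least the size of [F], hence past all entries from [B]. *)
  rewrite inE /L nth_cat size_list /sl index_cat mem_enum kF.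
  rewrite ltnNge (leq_trans m_le) ?cardE ?leq_addr //=.
  set p := (_ - _)%N; have : nth k (list (~: B)) p \in list (~: B).
    apply: mem_nth; rewrite -(ltn_add2l (size (list B))) -size_cat -/L.
    rewrite (etrans size_L (esym size_sl)).
    rewrite /p size_list subnKC; last by rewrite (leq_trans m_le) ?cardE ?leq_addr.
    by rewrite size_cat ltn_add2l index_mem mem_enum inE kF.
  by case/flatten_mapP => l; rewrite mem_enum inE => lB /nseqP[-> _].
apply/eqP/mnmP => l; rewrite mnm_sumE.
(* Read along [sl], the assignment returns [L], so each [l] is chosen [m l] times. *)
have LE : [seq nth k L (index k sl) | k <- sl] = L.
  case slE: sl => [|k0 sl0].
    by apply/esym/size0nil; rewrite size_L -[LHS]size_sl slE.
  rewrite -slE; apply: (@eq_from_nth _ k0); first by rewrite size_map size_L.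
  move=> p; rewrite size_map => psl.
  rewrite (nth_map k0) // index_uniq //; apply: set_nth_default.
  by rewrite size_L -size_sl.
transitivity (count_mem l [seq nth k L (index k sl) | k <- sl]).
  rewrite LE -(count_flatten_nseq m (enum_uniq 'I_n) (mem_enum _ l)).
  apply/seq.permP; rewrite /L /list -flatten_cat -map_cat.
  by apply/perm_flatten/perm_map; rewrite perm_sym.
rewrite count_map -sum1_count big_mkcond /= (perm_big _ (enum_perm F)) /=.
rewrite big_enum /=; apply: eq_bigr => k _.
by rewrite ffunE mnm1E; case: eqP.
Qed.

Lemma eq_transversal_base n (A A' : 'I_n -> {set 'I_n}) :
  A =1 A' -> transversal_base A =i transversal_base A'.
Proof.
move=> AA' m; apply: eq_existsb => j; congr (_ && _).
by apply: eq_forallb => k; rewrite AA'.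
Qed.

(** * Cyclic intervals as difference constraints *)

Section CyclicIntervals.
Variable n' : nat.
Local Notation n := n'.+1.
Implicit Types (m : 'X_{1..n}) (z : {ffun 'I_n -> int}).

Local Notation cyc u := (iter u (@ordS n) ord0).

Lemma sum_sigma_seg t i (f : 'I_n -> nat) : (i <= n)%N ->
  (\sum_(l in sigma_seg n t i) f l = \sum_(k < i) f (cyc (t + k)))%N.
Proof.
move=> i_n; rewrite big_imset /=; last by move=> k l _ _; apply: perm_inj.
rewrite (big_ord_widen n (fun k => f (cyc (t + k))) i_n).
apply: eq_big => k; first by rewrite inE.
move=> _; congr f; rewrite iterD iter_ordS_lt permX.
by elim: t => //= t ->; rewrite permE.
Qed.

(** The unrestricted positions are the [i] shifted ones and the image of the last index, whence the
    bound [i.+1]. *)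
Lemma mem_shifted_base t i m : (i <= n')%N ->
  m \in transversal_base (@shifted_family n t i) <->
  mdeg m = n /\ (\sum_(k < i) m (cyc (t + k)) <= i.+1)%N.
Proof.
move=> i_n; pose s : {perm 'I_n} := (sigma n ^- t)%g.
pose X := [set k : 'I_n | (k < i)%N || (k.+1 == n)].
have cardX : #|X| = i.+1.
  have -> : X = ord_max |: [set k : 'I_n | (k < i)%N].
    by apply/setP => k; rewrite !inE -val_eqE eqSS orbC.
  by rewrite cardsU1 inE /= ltnNge i_n (card_ord_lt (leqW i_n)).
rewrite -sum_sigma_seg ?(leqW i_n) // -cardX -(card_preimset X (@perm_inj _ s)).
rewrite -two_valued_transversal_base.
rewrite (@eq_transversal_base _ _ (fun k => if k \in s @^-1: X then setT
  else ~: sigma_seg n t i)) // => k.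
by rewrite !inE.
Qed.

Definition potential m : {ffun 'I_n -> int} :=
  [ffun j : 'I_n => (\sum_(l < n | (l < j)%N) m l)%:Z - j%:Z].

(** At the last index the cycle closes up because the total degree [n] cancels the subtracted
    index. *)
Lemma potential_ordS m j : mdeg m = n ->
  potential m (ordS j) - potential m j = (m j)%:Z - 1.
Proof.
move=> m_deg; pose S p := (\sum_(l < n | (l < p)%N) m l)%N.
have S_next : S j.+1 = (S j + m j)%N.
  rewrite /S (bigD1 j) //= addnC; congr addn; apply: eq_bigl => l.
  by rewrite ltnS [RHS]ltn_neqAle andbC.
rewrite !ffunE -/(S j) -/(S (ordS j)).
have := ltn_ord j; rewrite leq_eqVlt => /orP[/eqP jn|jn]; last first.
  by rewrite /= modn_small // S_next; lia.
have Sn : S n = n.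
  by rewrite -[RHS]m_deg mdegE; apply: eq_bigl => l; rewrite ltn_ord.
have S0 : S 0 = 0%N by rewrite /S big_pred0.
rewrite /= jn modnn S0; move: S_next; rewrite jn Sn; lia.
Qed.

Lemma exponent_potential m : mdeg m = n -> exponent 1 (potential m) = m.
Proof.
move=> m_deg; apply/mnmP => j; rewrite mnmE.
by have := potential_ordS j m_deg; lia.
Qed.

Section Exponent.
Variables (m : 'X_{1..n}) (z : {ffun 'I_n -> int}).
Hypothesis mE : forall j, (m j)%:Z = 1 + z (ordS j) - z j.

(** The sum telescopes, so the bound [i.+1] on an interval sum becomes a difference constraint with
    bound 1 between its end points. *)
Lemma sum_interval t i :
  (\sum_(k < i) m (cyc (t + k)))%:Z = i%:Z + z (cyc (t + i)) - z (cyc t).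
Proof.
elim: i => [|i IHi]; first by rewrite big_ord0 addn0; lia.
rewrite big_ord_recr /= PoszD IHi mE addnS /=; lia.
Qed.

Lemma mdeg_interval : mdeg m = n.
Proof.
apply/eqP; rewrite -eqz_nat mdegE -[X in X == _]natz natr_sum.
rewrite (eq_bigr (fun j => 1 + z (ordS j) - z j)) => [|j _]; last by rewrite natz mE.
rewrite sumrB big_split /= sumr_const card_ord natz.
by rewrite [X in _ - X](reindex_inj (@ordS_inj n)) /= addrK.
Qed.

End Exponent.

Definition constraints r (i t : 'I_r -> nat) : rel 'I_n := fun a b =>
  (a == ordS b) || [exists s, (a == cyc (t s)) && (b == cyc (t s + i s))].

Lemma constraints_cycle r (i t : 'I_r -> nat) j : constraints i t (ordS j) j.
Proof. by rewrite /constraints eqxx. Qed.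

Lemma mem_bases r (i t : 'I_r -> nat) m : (0 < r)%N ->
  (forall s, i s <= n')%N ->
  [forall s, m \in transversal_base (@shifted_family n (t s) (i s))] <->
  exists2 z, dilate (constraints i t) 1 z & m = exponent 1 z.
Proof.
move=> r_gt0 i_le; split=> [/forallP mP|[z zP ->]]; last first.
  have zE j := exponentE (@constraints_cycle _ i t) j zP.
  apply/forallP => s; apply/mem_shifted_base => //; split.
    exact: mdeg_interval zE.
  rewrite -lez_nat (sum_interval zE); case/dilateP: zP => _ /(_ (cyc (t s)) (cyc (t s + i s))).
  have -> : constraints i t (cyc (t s)) (cyc (t s + i s)).
    by apply/orP; right; apply/existsP; exists s; rewrite !eqxx.
  by move=> /(_ isT); lia.
have m_le s : (\sum_(k < i s) m (cyc (t s + k)) <= (i s).+1)%N.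
  by case/mem_shifted_base: (mP s).
(* Membership in any one of the bases fixes the degree, and $r>0$ supplies one. *)
have m_deg : mdeg m = n by case/mem_shifted_base: (mP (Ordinal r_gt0)).
exists (potential m); last by rewrite exponent_potential.
have zE j : (m j)%:Z = 1 + potential m (ordS j) - potential m j.
  by have := potential_ordS j m_deg; lia.
apply/dilateP; split=> [|a b]; first by rewrite ffunE big_pred0.
case/orP=> [/eqP ->|/existsP[s /andP[/eqP -> /eqP ->]]].
  by have := zE b; lia.
by have := sum_interval zE (t s) (i s); have := m_le s; lia.
Qed.

End CyclicIntervals.

Theorem corollary3p2 (K : fieldType) (n r : nat) (i t : 'I_r -> nat)
  (hn : (3 <= n)%N) (hr : (2 <= r)%N)
  (hi : forall s, (1 <= i s <= n - 2)%N)
  (ht1 : forall s : 'I_r, s = 0%N :> nat -> t s = 0%N)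
  (ht : forall s, (t s <= n - 1)%N) :
  is_a_invariant
    (monomial_algebra K
       [pred m : 'X_{1..n} |
          [forall s : 'I_r, m \in transversal_base (@shifted_family n (t s) (i s))]])
    (-1).
Proof.
case: n hn hi ht => [//|n'] _ hi _.
apply: (dilate_a_invariant (@constraints_cycle n' r i t)) => m.
apply: mem_bases; first exact: ltnW.
by move=> s; have := hi s; lia.
Qed.
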